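(* Assume that for every $\lambda\in\mathbb{R}^m$ the point $\bar z(\lambda)\in Z$ satisfies $$\min_{z\in Z}\langle \nabla\mathcal{L}_\rho(\bar z(\lambda),\lambda),\, z-\bar z(\lambda)\rangle \ge -\left(1+\sqrt{2L_{\mathrm p}}\,R_{\mathrm p}\right)\varepsilon_{\mathrm{in}} .$$ Let $(\lambda_k)_{k\ge0}$ be generated from $\lambda_0\in\mathbb{R}^m$ by $$\lambda_{k+1}=\lambda_k+\alpha_k\nabla\bar d_\rho(\lambda_k),\qquad \alpha_k\in[\underline L^{-1},L_{\mathrm d}^{-1}],$$ let $S_k=\sum_{j=0}^k\alpha_j$ and $\hat\lambda_k=S_k^{-1}\sum_{j=0}^k\alpha_j\lambda_{j+1}$. Then for every $k\ge1$ $$f^*-d_\rho(\hat\lambda_k)\le \frac{\underline L R_{\mathrm d}^2}{2(k+1)}+\left(1+\sqrt{2L_{\mathrm p}}\,R_{\mathrm p}\right)\varepsilon_{\mathrm{in}},$$ where $R_{\mathrm d}=\|\lambda_0-\lambda^*\|$.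
   Context: Setting: $f:\mathbb{R}^n\to\mathbb{R}$ is convex and differentiable, $A\in\mathbb{R}^{m\times n}$ has full row rank, $b\in\mathbb{R}^m$, $Z\subset\mathbb{R}^n$ is nonempty, compact and convex, $\rho>0$, $\varepsilon_{\mathrm{in}}>0$; $\|\cdot\|$ and $\langle\cdot,\cdot\rangle$ are the Euclidean norm and inner product. Primal problem: $f^*=\min\{f(z): Az=b,\ z\in Z\}$. Augmented Lagrangian: $\mathcal{L}_\rho(z,\lambda)=f(z)+\langle\lambda,Az-b\rangle+\frac\rho2\|Az-b\|^2$; $\nabla\mathcal{L}_\rho$ denotes its gradient in $z$, assumed Lipschitz continuous in $z$ on $\mathbb{R}^n$ with constant $L_{\mathrm p}>0$ for each $\lambda$. $R_{\mathrm p}=\max_{z,y\in Z}\|z-y\|$. Augmented dual function: $d_\rho(\lambda)=\min_{z\in Z}\mathcal{L}_\rho(z,\lambda)$. Slater's constraint qualification is assumed, so that $f^*=\max_{\lambda}\min_{z\in Z}\{f(z)+\langle\lambda,Az-b\rangle\}$; $\lambda^*$ denotes a maximizer of this dual problem (the ordinary dual and the problem $\max_\lambda d_\rho(\lambda)$ have the same optimal value and the same optimal solutions). $L_{\mathrm d}=1/\rho$ and $\underline L\ge L_{\mathrm d}$ is a fixed constant. Inexact dual information: for each $\lambda$ an approximate minimizer $\bar z(\lambda)\in Z$ of $\mathcal{L}_\rho(\cdot,\lambda)$ over $Z$ is fixed, and $\nabla\bar d_\rho(\lambda):=A\bar z(\lambda)-b$ (a notation, not necessarily a gradient). *)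

(* Defs.v *)
From HB Require Import structures.
From mathcomp Require Import all_boot all_order all_algebra.
From mathcomp Require Import all_classical all_reals all_analysis.

Set Implicit Arguments.
Unset Strict Implicit.
Unset Printing Implicit Defensive.

Import Order.TTheory GRing.Theory Num.Theory.
Import numFieldNormedType.Exports.

Local Open Scope classical_set_scope.
Local Open Scope ring_scope.

(* The library norm `|_| on matrices is the sup norm, so the Euclidean structure
   of R^n is defined here; both norms induce the same topology and the same
   notions of differentiability and compactness. *)
Definition dotp (R : realType) (n : nat) (u v : 'cV[R]_n) : R :=
  \sum_(i < n) u i 0 * v i 0.

Definition enorm (R : realType) (n : nat) (u : 'cV[R]_n) : R :=
  Num.sqrt (dotp u u).

(* The vector of partial derivatives. *)
Definition gradient (R : realType) (n : nat) (g : 'cV[R]_n -> R)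
    (z : 'cV[R]_n) : 'cV[R]_n :=
  \col_(i < n) 'D_(delta_mx i 0) g z.

Definition affine_set (R : realType) (n : nat) (M : set 'cV[R]_n) : Prop :=
  forall (x y : 'cV[R]_n) (t : R), M x -> M y -> M ((1 - t) *: x + t *: y).

Definition affine_hull (R : realType) (n : nat) (Z : set 'cV[R]_n) :
    set 'cV[R]_n :=
  \bigcap_(M in [set M | affine_set M /\ Z `<=` M]) M.

Definition relint (R : realType) (n : nat) (Z : set 'cV[R]_n) : set 'cV[R]_n :=
  [set z | affine_hull Z z /\
     exists2 e : R, 0 < e &
       forall y, affine_hull Z y -> enorm (y - z) < e -> Z y].

(* All constraints being affine equalities, Slater's condition asks for a
   feasible point in the relative interior of Z. *)
Definition slater (R : realType) (m n : nat) (A : 'M[R]_(m, n)) (b : 'cV[R]_m)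
    (Z : set 'cV[R]_n) : Prop :=
  exists2 z, relint Z z & A *m z = b.

Definition diameter (R : realType) (n : nat) (Z : set 'cV[R]_n) : R :=
  sup [set enorm (p.1 - p.2) | p in Z `*` Z].

(* The minima and maxima below are written with inf and sup: they are attained
   when Z is compact and nonempty and the functions involved are continuous. *)
Definition primal_value (R : realType) (m n : nat) (f : 'cV[R]_n -> R)
    (A : 'M[R]_(m, n)) (b : 'cV[R]_m) (Z : set 'cV[R]_n) : R :=
  inf [set f z | z in [set z | A *m z = b /\ Z z]].

Definition lagrangian (R : realType) (m n : nat) (f : 'cV[R]_n -> R)
    (A : 'M[R]_(m, n)) (b : 'cV[R]_m) (z : 'cV[R]_n) (lam : 'cV[R]_m) : R :=
  f z + dotp lam (A *m z - b).

Definition dual_fun (R : realType) (m n : nat) (f : 'cV[R]_n -> R)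
    (A : 'M[R]_(m, n)) (b : 'cV[R]_m) (Z : set 'cV[R]_n) (lam : 'cV[R]_m) : R :=
  inf [set lagrangian f A b z lam | z in Z].

Definition dual_maximizer (R : realType) (m n : nat) (f : 'cV[R]_n -> R)
    (A : 'M[R]_(m, n)) (b : 'cV[R]_m) (Z : set 'cV[R]_n)
    (lamstar : 'cV[R]_m) : Prop :=
  forall lam, dual_fun f A b Z lam <= dual_fun f A b Z lamstar.

Definition aug_lagrangian (R : realType) (m n : nat) (f : 'cV[R]_n -> R)
    (A : 'M[R]_(m, n)) (b : 'cV[R]_m) (rho : R)
    (z : 'cV[R]_n) (lam : 'cV[R]_m) : R :=
  f z + dotp lam (A *m z - b) + rho / 2 * enorm (A *m z - b) ^+ 2.

Definition grad_aug (R : realType) (m n : nat) (f : 'cV[R]_n -> R)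
    (A : 'M[R]_(m, n)) (b : 'cV[R]_m) (rho : R)
    (z : 'cV[R]_n) (lam : 'cV[R]_m) : 'cV[R]_n :=
  gradient (fun y => aug_lagrangian f A b rho y lam) z.

Definition aug_dual (R : realType) (m n : nat) (f : 'cV[R]_n -> R)
    (A : 'M[R]_(m, n)) (b : 'cV[R]_m) (rho : R) (Z : set 'cV[R]_n)
    (lam : 'cV[R]_m) : R :=
  inf [set aug_lagrangian f A b rho z lam | z in Z].

Definition inexact_grad (R : realType) (m n : nat) (A : 'M[R]_(m, n))
    (b : 'cV[R]_m) (zbar : 'cV[R]_m -> 'cV[R]_n) (lam : 'cV[R]_m) : 'cV[R]_m :=
  A *m zbar lam - b.

Definition step_sum (R : realType) (alpha : nat -> R) (k : nat) : R :=
  \sum_(j < k.+1) alpha j.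

Definition avg_iterate (R : realType) (m : nat) (alpha : nat -> R)
    (lam : nat -> 'cV[R]_m) (k : nat) : 'cV[R]_m :=
  (step_sum alpha k)^-1 *: \sum_(j < k.+1) alpha j *: lam j.+1.

(* Main.v *)
Require Import Defs.
From mathcomp Require Import all_boot all_order all_algebra.
From mathcomp Require Import all_classical all_reals all_analysis.
From mathcomp Require Import ring lra.
Set Implicit Arguments.
Unset Strict Implicit.
Unset Printing Implicit Defensive.

Import Order.TTheory GRing.Theory Num.Theory.
Import numFieldNormedType.Exports.
Local Open Scope classical_set_scope.
Local Open Scope ring_scope.

(* Write r = A zbar(lam) - b and mu = lam + rho r.  Since the gradient of the
   augmented Lagrangian at zbar(lam) is that of the ordinary Lagrangian with
   multiplier mu, convexity turns the inexactness condition into: zbar(lam)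
   minimizes the ordinary Lagrangian at mu over Z up to the error E.  Moreover
   the augmented dual dominates dual(mu) - |mu - nu|^2 / (2 rho) at every nu.
   Together with strong duality, f* <= dual(lamstar) <= f(zbar) + <lamstar, r>,
   this gives, at nu = lam + a r with 0 <= a <= rho,
     a (f* - d_rho(nu)) <= (|lam - lamstar|^2 - |nu - lamstar|^2) / 2 + a E.
   Summing telescopes, and d_rho is concave.  Strong duality itself comes from
   minimizing the quadratic penalty f + c/2 |A z - b|^2 over the compact set Z
   and letting c grow. *)

(** * Euclidean inner product, gradients, and differentiability of residuals *)

Section InnerProduct.
Context {R : realType}.

Lemma dotpC n (u v : 'cV[R]_n) : dotp u v = dotp v u.
Proof. by apply: eq_bigr => i _; rewrite mulrC. Qed.

Lemma dotpDl n (u v w : 'cV[R]_n) : dotp (u + v) w = dotp u w + dotp v w.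
Proof. by rewrite -big_split; apply: eq_bigr => i _; rewrite mxE mulrDl. Qed.

Lemma dotpZl n (a : R) (u v : 'cV[R]_n) : dotp (a *: u) v = a * dotp u v.
Proof.
by rewrite /dotp mulr_sumr; apply: eq_bigr => i _; rewrite mxE mulrA.
Qed.

Lemma dotpDr n (u v w : 'cV[R]_n) : dotp u (v + w) = dotp u v + dotp u w.
Proof. by rewrite dotpC dotpDl ![dotp _ u]dotpC. Qed.

Lemma dotpZr n (a : R) (u v : 'cV[R]_n) : dotp u (a *: v) = a * dotp u v.
Proof. by rewrite dotpC dotpZl dotpC. Qed.

Lemma dotpNl n (u v : 'cV[R]_n) : dotp (- u) v = - dotp u v.
Proof. by rewrite -scaleN1r dotpZl mulN1r. Qed.

Lemma dotpNr n (u v : 'cV[R]_n) : dotp u (- v) = - dotp u v.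
Proof. by rewrite dotpC dotpNl dotpC. Qed.

Lemma dotp0l n (u : 'cV[R]_n) : dotp 0 u = 0.
Proof. by rewrite -(scale0r 0) dotpZl mul0r. Qed.

Lemma dotp_suml n (I : Type) (r : seq I) (F : I -> 'cV[R]_n) (v : 'cV[R]_n) :
  dotp (\sum_(i <- r) F i) v = \sum_(i <- r) dotp (F i) v.
Proof.
elim/big_rec2: _ => [|i x y _ <-]; first by rewrite dotp0l.
by rewrite dotpDl.
Qed.

Lemma dotp_ge0 n (u : 'cV[R]_n) : 0 <= dotp u u.
Proof. by apply: sumr_ge0 => i _; rewrite -expr2 sqr_ge0. Qed.

Lemma dotp_eq0 n (u : 'cV[R]_n) : dotp u u = 0 -> u = 0.
Proof.
move=> /eqP; rewrite psumr_eq0; last by move=> i _; rewrite -expr2 sqr_ge0.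
move=> /allP u0; apply/colP => i; rewrite mxE; apply/eqP.
by have := u0 i (mem_index_enum _); rewrite /= mulf_eq0 orbb.
Qed.

Lemma sqr_enorm n (u : 'cV[R]_n) : enorm u ^+ 2 = dotp u u.
Proof. by rewrite /enorm sqr_sqrtr// dotp_ge0. Qed.

(** Differentiability makes ['D_h g z] linear in [h], so expanding [h] in the standard basis
    recovers the partial derivatives. *)
Lemma dotp_gradient n (g : 'cV[R]_n -> R) (z h : 'cV[R]_n) :
  differentiable g z -> dotp (gradient g z) h = 'D_h g z.
Proof.
move=> dg; rewrite deriveE//.
have {2}-> : h = \sum_i h i 0 *: delta_mx i 0.
  by rewrite {1}[h]matrix_sum_delta; apply: eq_bigr => i _; rewrite big_ord1.
rewrite linear_sum; apply: eq_bigr => i _.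
by rewrite mxE linearZ/= deriveE// mulrC.
Qed.

Lemma differentiable_dotp m n (F G : 'cV[R]_n -> 'cV[R]_m) (z : 'cV[R]_n) :
  (forall i, differentiable (fun y => F y i 0) z) ->
  (forall i, differentiable (fun y => G y i 0) z) ->
  differentiable (fun y => dotp (F y) (G y)) z.
Proof.
move=> dF dG; rewrite (_ : (fun _ => _) =
  \sum_(i < m) ((fun y => F y i 0) * (fun y => G y i 0))); last first.
  by apply/funext => y; rewrite fct_sumE.
by apply: differentiable_sum => i; apply: differentiableM.
Qed.

Lemma differentiable_residual m n (A : 'M[R]_(m, n)) (b : 'cV[R]_m) i z :
  differentiable (fun y : 'cV[R]_n => (A *m y - b) i 0) z.
Proof.
rewrite (_ : (fun _ => _) =
  (\sum_(j < n) (A i j *: ((fun y => y j 0) : 'cV[R]_n -> R))) - cst (b i 0)).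
  apply: differentiableB => //; apply: differentiable_sum => j.
  by apply: differentiableZ; exact: differentiable_coord.
by apply/funext => y; rewrite !mxE/= /GRing.add/= /GRing.opp/= fct_sumE.
Qed.

End InnerProduct.

(** * Directional derivatives estimated along a segment *)

Section OneSidedDerivatives.
Context {R : realType} {V : normedModType R}.
Variables (g : V -> R) (z h : V).
Hypothesis dg : derivable g z h.

Let cvg_quotient :
  (fun t => t^-1 *: ((g \o shift z) (t *: h) - g z)) t @[t --> 0^'+]
    --> 'D_h g z.
Proof. by apply: cvg_dnbhs_at_right; exact: dg. Qed.

(** After division by [t > 0] the quadratic term vanishes as [t] tends to 0 from the right. Small
    positive [t] suffice, which is all that convexity along a segment provides. *)
Lemma derive_le_of_quadratic_bound (X Y : R) :
  (forall t, 0 < t <= 1 -> g (t *: h + z) - g z <= t * X + t ^+ 2 * Y) ->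
  'D_h g z <= X.
Proof.
move=> gXY.
have cvgX : (fun t : R => X + t * Y) t @[t --> 0^'+] --> X + 0 * Y.
  apply: cvg_at_right_filter; apply: cvgD; first exact: cvg_cst.
  by apply: cvgM; [exact: cvg_id|exact: cvg_cst].
rewrite mul0r addr0 in cvgX.
apply: (ler_cvg_to cvg_quotient cvgX).
near=> t; have t0 : 0 < t by near: t; exact: nbhs_right_gt.
have t1 : t <= 1 by near: t; exact: nbhs_right_ltW.
rewrite /= -[_ *: _]/(_ * _) ler_pdivrMl// mulrDr mulrA -expr2.
by apply: gXY; rewrite t0.
Unshelve. all: by end_near. Qed.

Lemma derive_ge0_of_min :
  (forall t, 0 < t <= 1 -> g z <= g (t *: h + z)) -> 0 <= 'D_h g z.
Proof.
move=> gmin.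
have cvg0 : (fun=> 0 : R) t @[t --> (0 : R)^'+] --> (0 : R) by exact: cvg_cst.
apply: (ler_cvg_to cvg0 cvg_quotient).
near=> t; have t0 : 0 < t by near: t; exact: nbhs_right_gt.
have t1 : t <= 1 by near: t; exact: nbhs_right_ltW.
rewrite /= -[_ *: _]/(_ * _) mulr_ge0 ?invr_ge0 ?(ltW t0)// subr_ge0.
by apply: gmin; rewrite t0.
Unshelve. all: by end_near. Qed.

End OneSidedDerivatives.

(** [inf] takes a default value on sets without a lower bound; the minimum attained on [K] supplies
    one. *)
Lemma ge_inf_image_compact {R : realType} {T : topologicalType} (g : T -> R)
    (K : set T) (x : T) :
  continuous g -> compact K -> K x -> inf [set g y | y in K] <= g x.
Proof.
move=> cg cK Kx; apply: ge_inf; last by exists x.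
have [|c _ cmin] := @compact_EVT_min _ _ g K _ cK (continuous_subspaceT cg).
  by exists x.
by exists (g c) => _ [y Ky <-]; apply: cmin; rewrite inE.
Qed.

(** Near a zero of [q] in [K], [g] alone stays above [D]; near any other point [q] is bounded away
    from 0 and a large coefficient wins. Compactness, in its near-covering form, merges the local
    thresholds into one. *)
Lemma penalty_exceeds {R : realType} {T : topologicalType} (g q : T -> R)
    (K : set T) (D : R) :
  continuous g -> continuous q -> compact K -> (forall x, 0 <= q x) ->
  (forall x, K x -> q x = 0 -> D < g x) ->
  exists c : R, forall x, K x -> D < g x + c * q x.
Proof.
move=> cg cq /compact_near_coveringP cK q0 gD.
have [] := cK nat \oo (fun i x => D < g x + i.+1%:R * q x).
  move=> x Kx; have [qx0|qx0] := eqVneq (q x) 0.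
    exists ([set y | D < g y], setT) => /=.
      by split; [exact: (cvgr_gt _ (cg x) _ (gD x Kx qx0))|exact: filterT].
    move=> [y i] [/= Dgy _]; apply: (lt_le_trans Dgy).
    by rewrite lerDl mulr_ge0.
  have qx_gt0 : 0 < q x by rewrite lt_neqAle eq_sym qx0 q0.
  (* Nearby, [g] loses at most 1 and [q] keeps half of its value, so a coefficient above this
     quotient suffices; the successor in [i.+1] makes up for the truncation. *)
  pose N := Num.truncn ((D - g x + 1) / (q x / 2)).
  have q2 : q x / 2 < q x by rewrite gtr_pMr// invf_lt1// ltr1n.
  exists ([set y | g x - 1 < g y] `&` [set y | q x / 2 < q y],
          [set i | (N <= i)%N]) => /=.
    split; last exact: nbhs_infty_ge.
    apply: filterI; last exact: (cvgr_gt _ (cq x)).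
    by apply: (cvgr_gt _ (cg x)); rewrite ltrBlDr ltrDl.
  move=> [y i] [/= [gy qy] Ni].
  have DN : (D - g x + 1) / (q x / 2) <= i.+1%:R.
    by apply: le_trans (ltW (truncnS_gt _)) _; rewrite ler_nat.
  have : i.+1%:R * (q x / 2) <= i.+1%:R * q y by rewrite ler_pM2l// ltW.
  by move: DN; rewrite ler_pdivrMr ?divr_gt0//; lra.
move=> N _ /(_ N (leqnn _)) KN.
by exists N.+1%:R.
Qed.

(** * Lagrangian inequalities, strong duality and one dual step *)

Section AugmentedLagrangian.
Context {R : realType} {m n : nat}.
Variables (f : 'cV[R]_n -> R) (A : 'M[R]_(m, n)) (b : 'cV[R]_m).
Variable Z : set 'cV[R]_n.
Hypothesis f_convex : convex_function setT f.
Hypothesis f_diff : forall z, differentiable f z.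

Lemma convex_function_le (z y : 'cV[R]_n) (t : R) :
  0 < t <= 1 -> f (t *: (z - y) + y) <= f y + t * (f z - f y).
Proof.
move=> /andP[t0 t1].
have : f (t *: z + (1 - t) *: y) <= t * f z + (1 - t) * f y.
  exact: (@f_convex (Itv01 (ltW t0) t1) z y (mem_set I) (mem_set I)).
rewrite scalerBr scalerBl scale1r -!addrA [- _ + y]addrC; lra.
Qed.

Lemma convex_set_segment (z y : 'cV[R]_n) (t : R) :
  convex_set Z -> Z z -> Z y -> 0 < t <= 1 -> Z (t *: (z - y) + y).
Proof.
move=> cZ /mem_set Zz /mem_set Zy /andP[t0 t1].
have : Z (t *: z + (1 - t) *: y).
  by apply/set_mem; exact: (cZ _ _ (Itv01 (ltW t0) t1) Zz Zy).
by rewrite scalerBr scalerBl scale1r -!addrA [- _ + y]addrC.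
Qed.

Lemma differentiable_lagrangian (lam : 'cV[R]_m) (z : 'cV[R]_n) :
  differentiable (fun y => lagrangian f A b y lam) z.
Proof.
apply: differentiableD => //; apply: differentiable_dotp => i //.
exact: differentiable_residual.
Qed.

Lemma differentiable_aug_lagrangian (rho : R) (lam : 'cV[R]_m) (z : 'cV[R]_n) :
  differentiable (fun y => aug_lagrangian f A b rho y lam) z.
Proof.
apply: differentiableD; first exact: differentiable_lagrangian.
apply: differentiableZ.
rewrite (_ : (fun _ => _) = fun y => dotp (A *m y - b) (A *m y - b)).
  by apply: differentiable_dotp => i; exact: differentiable_residual.
by apply/funext => y; exact: sqr_enorm.
Qed.

(** On the segment from [y] to [z] the penalty grows by [t * rho * dotp r s], which moves the
    multiplier from [lam] to [mu], plus a term in [t ^+ 2]. Convexity bounds the growth of [f], so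
    the slope is at most the Lagrangian gap at [mu]. *)
Lemma lagrangian_ge_of_derive_ge (rho E : R) (lam : 'cV[R]_m) (z y : 'cV[R]_n)
    (mu : 'cV[R]_m := lam + rho *: (A *m y - b)) :
  - E <= 'D_(z - y) (fun x => aug_lagrangian f A b rho x lam) y ->
  lagrangian f A b y mu - E <= lagrangian f A b z mu.
Proof.
move=> ED; pose r : 'cV[R]_m := A *m y - b; pose s : 'cV[R]_m := A *m (z - y).
have zE : A *m z - b = s + r by rewrite /s /r mulmxBr addrA subrK.
suff : 'D_(z - y) (fun x => aug_lagrangian f A b rho x lam) y <=
    f z - f y + dotp mu s.
  rewrite /lagrangian zE -/r [dotp mu (s + r)]dotpDr; lra.
apply: (@derive_le_of_quadratic_bound _ _ _ _ _ _ _ (rho / 2 * dotp s s)).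
  exact/diff_derivable/differentiable_aug_lagrangian.
move=> t t01; have := convex_function_le z y t01.
have tE : A *m (t *: (z - y) + y) - b = t *: s + r.
  by rewrite mulmxDr -scalemxAr -addrA.
rewrite /aug_lagrangian !sqr_enorm tE -/r /mu -/r.
clearbody r s; rewrite !(dotpDl, dotpDr, dotpZl, dotpZr) (dotpC s r); lra.
Qed.

(* Half of the Moreau envelope formula
   [d_rho lam = max_d (dual_fun (lam + d) - |d|^2 / (2 rho))]. *)
Lemma lagrangian_le_aug_lagrangian (rho : R) (lam d : 'cV[R]_m) z : 0 < rho ->
  lagrangian f A b z (lam + d) - dotp d d / (2 * rho) <=
    aug_lagrangian f A b rho z lam.
Proof.
move=> rho0; rewrite /lagrangian /aug_lagrangian sqr_enorm.
set r : 'cV[R]_m := A *m z - b; clearbody r.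
(* Completing the square: the gap between the two sides is [dotp (rho *: r - d) (rho *: r - d) / (2
   * rho)]. *)
have := dotp_ge0 (rho *: r - d).
rewrite !(dotpDl, dotpDr, dotpZl, dotpZr, dotpNl, dotpNr) (dotpC r d) => sq.
rewrite -subr_ge0.
suff -> : f z + dotp lam r + rho / 2 * dotp r r -
   (f z + (dotp lam r + dotp d r) - dotp d d / (2 * rho)) =
  (2 * rho)^-1 * (rho * (rho * dotp r r) - rho * dotp d r
    - (rho * dotp d r - dotp d d)).
  by apply: mulr_ge0; [rewrite invr_ge0; lra|lra].
by field; lra.
Qed.

Lemma dual_fun_le_lagrangian lam z :
  compact Z -> Z z -> dual_fun f A b Z lam <= lagrangian f A b z lam.
Proof.
move=> cZ Zz.
apply: (@ge_inf_image_compact _ _ (fun z => lagrangian f A b z lam)) => // y.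
exact/differentiable_continuous/differentiable_lagrangian.
Qed.

(* The multiplier [c (A z_c - b)] of a minimizer [z_c] of the quadratic penalty
   has dual value at least [f z_c + c |A z_c - b|^2], and by compactness this
   exceeds any level below the primal value when [c] is large. *)
Lemma primal_value_le_dual lamstar :
  compact Z -> convex_set Z -> Z !=set0 -> dual_maximizer f A b Z lamstar ->
  primal_value f A b Z <= dual_fun f A b Z lamstar.
Proof.
move=> cZ convZ Z0 maxl; rewrite leNgt; apply/negP => Dlt.
have cf : continuous f by move=> y; exact/differentiable_continuous.
have cq : continuous (fun z => dotp (A *m z - b) (A *m z - b)).
  move=> y; apply/differentiable_continuous.
  by apply: differentiable_dotp => i; exact: differentiable_residual.
have feasible z : Z z -> dotp (A *m z - b) (A *m z - b) = 0 ->
    dual_fun f A b Z lamstar < f z.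
  move=> Zz /dotp_eq0 /eqP; rewrite subr_eq0 => /eqP Azb.
  apply: lt_le_trans Dlt _; apply: ge_inf; last by exists z.
  have [c _ cmin] := compact_EVT_min Z0 cZ (continuous_subspaceT cf).
  by exists (f c) => _ [y [_ Zy] <-]; apply: cmin; rewrite inE.
have [c cD] :=
  penalty_exceeds cf cq cZ (fun z => dotp_ge0 _) feasible.
(* With multiplier 0 the augmented Lagrangian is the quadratic penalty function. *)
have cL : continuous (fun y => aug_lagrangian f A b c y 0).
  by move=> y; exact/differentiable_continuous/differentiable_aug_lagrangian.
have [y + ymin] := compact_EVT_min Z0 cZ (continuous_subspaceT cL).
rewrite inE => Zy; set mu := 0 + c *: (A *m y - b).
have : lagrangian f A b y mu <= dual_fun f A b Z mu.
  apply: lb_le_inf; first exact: image_nonempty.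
  (* An exact minimizer is the case of error 0. *)
  move=> _ [z Zz <-]; rewrite -[leLHS]subr0.
  apply: lagrangian_ge_of_derive_ge; rewrite oppr0.
  apply: derive_ge0_of_min.
    exact/diff_derivable/differentiable_aug_lagrangian.
  by move=> t t01; apply: ymin; rewrite inE; exact: convex_set_segment.
(* The Lagrangian of [y] at [mu] equals [f y] plus [c] times the squared residual: it exceeds the
   dual value at [lamstar], yet is at most the dual value at [mu]. *)
have := maxl mu; have := cD _ Zy.
rewrite /lagrangian /mu add0r dotpZl; lra.
Qed.

Lemma dual_step_descent (rho a E P : R) (lam lamstar : 'cV[R]_m)
    (y z : 'cV[R]_n) (r : 'cV[R]_m := A *m y - b) :
  0 < rho -> 0 <= a <= rho -> P <= lagrangian f A b y lamstar ->
  lagrangian f A b y (lam + rho *: r) - E <=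
    lagrangian f A b z (lam + rho *: r) ->
  a * (P - aug_lagrangian f A b rho z (lam + a *: r)) <=
    (enorm (lam - lamstar) ^+ 2 - enorm (lam + a *: r - lamstar) ^+ 2) / 2
      + a * E.
Proof.
move=> rho0 /andP[a0 arho] Ple Lle.
(* This shift leads from the new iterate to [lam + rho *: r], the multiplier at which [y] is nearly
   optimal. *)
have := lagrangian_le_aug_lagrangian (lam + a *: r) ((rho - a) *: r) z rho0.
have -> : lam + a *: r + (rho - a) *: r = lam + rho *: r.
  by rewrite -addrA -scalerDl (addrC a) subrK.
set L := aug_lagrangian _ _ _ _ _ _; set K := lagrangian _ _ _ z _ in Lle *.
move: Ple Lle; rewrite /lagrangian -/r !sqr_enorm.
clearbody r L K.
rewrite !(dotpDl, dotpDr, dotpZl, dotpZr, dotpNl, dotpNr).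
rewrite (dotpC r lam) (dotpC r lamstar) (dotpC lamstar lam).
set rr := dotp r r; have rr0 : 0 <= rr := dotp_ge0 r.
move=> Ple Lle LK.
(* The cost of the shift leaves [a * rr / 2] out of the gain [rho * rr]; times [a], this is the
   quadratic term in the change of half the squared distance to [lamstar]. *)
have sq : (rho - a) * ((rho - a) * rr) / (2 * rho) <= rho * rr - a * rr / 2.
  rewrite ler_pdivrMr; last lra.
  have : 0 <= rr * (rho * rho + a * (rho - a)).
    by apply: mulr_ge0 => //; apply: addr_ge0; apply: mulr_ge0; lra.
  lra.
have : 0 <= a * (dotp lamstar r - dotp lam r - a * rr / 2 + E - (P - L)).
  by apply: mulr_ge0 => //; lra.
lra.
Qed.

End AugmentedLagrangian.

(** For fixed [z] the augmented Lagrangian is affine in the multiplier, and the weights sum to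
    [step_sum alpha k]. This is how concavity of the dual function enters, before any infimum is
    taken. *)
Lemma aug_lagrangian_avg_iterate (R : realType) (m n : nat)
    (f : 'cV[R]_n -> R) (A : 'M[R]_(m, n)) (b : 'cV[R]_m) (rho : R)
    (z : 'cV[R]_n) (alpha : nat -> R) (lam : nat -> 'cV[R]_m) (k : nat) :
  step_sum alpha k != 0 ->
  step_sum alpha k * aug_lagrangian f A b rho z (avg_iterate alpha lam k) =
  \sum_(j < k.+1) alpha j * aug_lagrangian f A b rho z (lam j.+1).
Proof.
move=> S0; rewrite /aug_lagrangian /avg_iterate dotpZl.
set c := _ * _ ^+ 2; set r : 'cV[R]_m := _ - b.
have -> : step_sum alpha k * (f z + (step_sum alpha k)^-1 *
      dotp (\sum_(j < k.+1) alpha j *: lam j.+1) r + c) =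
    step_sum alpha k * (f z + c) + dotp (\sum_(j < k.+1) alpha j *: lam j.+1) r.
  by field.
rewrite dotp_suml mulr_suml -big_split; apply: eq_bigr => j _ /=.
by rewrite dotpZl; ring.
Qed.

Theorem theorem3p2 (R : realType) (m n : nat)
  (f : 'cV[R]_n -> R) (A : 'M[R]_(m, n)) (b : 'cV[R]_m) (Z : set 'cV[R]_n)
  (rho eps_in Lp Lund : R) (lamstar : 'cV[R]_m)
  (zbar : 'cV[R]_m -> 'cV[R]_n) (alpha : nat -> R) (lam : nat -> 'cV[R]_m)
  (f_convex : convex_function setT f)
  (f_diff : forall z, differentiable f z)
  (A_full_row_rank : row_free A)
  (Z_nonempty : Z !=set0)
  (Z_compact : compact Z)
  (Z_convex : convex_set Z)
  (rho_gt0 : 0 < rho)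
  (eps_in_gt0 : 0 < eps_in)
  (Lp_gt0 : 0 < Lp)
  (grad_lipschitz : forall (mu : 'cV[R]_m) (z y : 'cV[R]_n),
    enorm (grad_aug f A b rho z mu - grad_aug f A b rho y mu)
      <= Lp * enorm (z - y))
  (slater_cq : slater A b Z)
  (lamstar_max : dual_maximizer f A b Z lamstar)
  (Lund_ge : rho^-1 <= Lund)
  (zbar_in : forall mu, Z (zbar mu))
  (zbar_inexact : forall mu,
    inf [set dotp (grad_aug f A b rho (zbar mu) mu) (z - zbar mu) | z in Z]
      >= - ((1 + Num.sqrt (2 * Lp) * diameter Z) * eps_in))
  (alpha_bounds : forall k, Lund^-1 <= alpha k <= (rho^-1)^-1)
  (lam_step : forall k,
    lam k.+1 = lam k + alpha k *: inexact_grad A b zbar (lam k))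
  (k : nat) (k_ge1 : (1 <= k)%N) :
  primal_value f A b Z - aug_dual f A b rho Z (avg_iterate alpha lam k)
    <= Lund * enorm (lam 0%N - lamstar) ^+ 2 / (2 * k.+1%:R)
       + (1 + Num.sqrt (2 * Lp) * diameter Z) * eps_in.
Proof.
move: zbar_inexact; set E := (1 + _) * eps_in => zbar_inexact.
set P := primal_value f A b Z; set S := step_sum alpha k.
have Lund0 : 0 < Lund by apply: lt_le_trans Lund_ge; rewrite invr_gt0.
have alpha0 j : 0 < alpha j.
  by have /andP[+ _] := alpha_bounds j; apply: lt_le_trans; rewrite invr_gt0.
have S_ge : k.+1%:R / Lund <= S.
  rewrite mulr_natl -[k.+1]card_ord -sumr_const.
  by apply: ler_sum => j _; have /andP[] := alpha_bounds j.
have S0 : 0 < S by apply: lt_le_trans S_ge; rewrite divr_gt0.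
have step z j : Z z -> alpha j * (P - aug_lagrangian f A b rho z (lam j.+1)) <=
    (enorm (lam j - lamstar) ^+ 2 - enorm (lam j.+1 - lamstar) ^+ 2) / 2
      + alpha j * E.
  move=> Zz; rewrite lam_step /inexact_grad.
  apply: dual_step_descent => //.
  - by have /andP[_] := alpha_bounds j; rewrite invrK (ltW (alpha0 j)) => ->.
  - apply: le_trans (primal_value_le_dual _ _ _ _ _ lamstar_max) _ => //.
    exact: dual_fun_le_lagrangian.
  apply: lagrangian_ge_of_derive_ge => //.
  rewrite -dotp_gradient; last exact: differentiable_aug_lagrangian.
  apply: le_trans (zbar_inexact (lam j)) _.
  pose g (y : 'cV[R]_n) :=
    dotp (grad_aug f A b rho (zbar (lam j)) (lam j)) (y - zbar (lam j)).
  suff cg : continuous g by exact: (ge_inf_image_compact cg Z_compact Zz).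
  move=> y; apply: differentiable_continuous.
  apply: differentiable_dotp => i //.
  (* A translation is a residual with identity matrix. *)
  have := differentiable_residual 1%:M (zbar (lam j)) i y.
  by under eq_fun do rewrite mul1mx.
have main z : Z z -> P - Lund * enorm (lam 0%N - lamstar) ^+ 2 / (2 * k.+1%:R)
    - E <= aug_lagrangian f A b rho z (avg_iterate alpha lam k).
  move=> Zz.
  have : \sum_(j < k.+1) alpha j *
        (P - aug_lagrangian f A b rho z (lam j.+1)) <=
      \sum_(j < k.+1) ((enorm (lam j - lamstar) ^+ 2 -
        enorm (lam j.+1 - lamstar) ^+ 2) / 2 + alpha j * E).
    by apply: ler_sum => j _; exact: step.
  under eq_bigr do rewrite mulrBr.
  rewrite sumrB big_split/= -!mulr_suml -aug_lagrangian_avg_iterate ?gt_eqF//.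
  rewrite -/S -(big_mkord xpredT (fun j => enorm (lam j - lamstar) ^+ 2 -
    enorm (lam j.+1 - lamstar) ^+ 2)).
  (* [telescope_sumr] sums later minus earlier terms, hence the change of sign. *)
  under eq_bigr do rewrite -opprB.
  rewrite sumrN telescope_sumr// opprB.
  set L := aug_lagrangian _ _ _ _ _ _; set D := _ ^+ 2; set D' := _ ^+ 2.
  have D0 : 0 <= D by rewrite sqr_ge0.
  have D'0 : 0 <= D' by rewrite sqr_ge0.
  rewrite -!/(step_sum alpha k) -!/S => sumle.
  have K0 : 0 < k.+1%:R :> R by [].
  (* Telescoping leaves [(D - D') / 2] with [D'] nonnegative. The lower bound on [S] turns [D / 2]
     into [S] times the target term, and dividing by [S] finishes. *)
  have DS : D / 2 <= S * (Lund * D / (2 * k.+1%:R)).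
    have -> : D / 2 = k.+1%:R / Lund * (Lund * D / (2 * k.+1%:R)).
      move: k.+1%:R K0 => K K0; field; lra.
    apply: ler_wpM2r => //.
    by apply: divr_ge0; apply: mulr_ge0; rewrite ?ler0n ?(ltW Lund0).
  rewrite -(ler_pM2l S0); move: (Lund * D / _) DS => X DS; lra.
have : P - Lund * enorm (lam 0%N - lamstar) ^+ 2 / (2 * k.+1%:R) - E <=
    aug_dual f A b rho Z (avg_iterate alpha lam k).
  apply: lb_le_inf; first exact: image_nonempty.
  by move=> _ [z Zz <-]; exact: main.
move: (Lund * _ / _) => X; lra.
Qed.
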